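(* Let $X$ be a real Banach space, $X\neq\{0\}$. If $X$ has the local diameter 2 property+ (LD2P+), then the bidual $X^{**}$ is not smooth.
   Context: $B_X$ and $S_X$ denote the closed unit ball and the unit sphere of $X$; $X^*$ is the topological dual. For $x^*\in S_{X^*}$ and $\varepsilon>0$, $S(x^*,\varepsilon)=\{x\in B_X : x^*(x)>1-\varepsilon\}$. $X$ has the local diameter 2 property+ (LD2P+) if for every $x^*\in S_{X^*}$, every $\varepsilon>0$, every $\delta>0$, and every $x\in S(x^*,\varepsilon)\cap S_X$ there exists $y\in S(x^*,\varepsilon)$ with $\|x-y\|>2-\delta$. A Banach space $Z$ is smooth if for every $x\in S_Z$ there is exactly one $x^*\in S_{Z^*}$ with $x^*(x)=1$. *)

(* Defs.v *)
From HB Require Import structures.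
From mathcomp Require Import all_boot all_order all_algebra.
From mathcomp Require Import all_classical all_reals all_analysis.

Set Implicit Arguments.
Unset Strict Implicit.
Unset Printing Implicit Defensive.

Import Order.TTheory GRing.Theory Num.Theory.
Import numFieldNormedType.Exports.

Local Open Scope classical_set_scope.
Local Open Scope ring_scope.

Definition unit_ball (R : realType) (X : normedModType R) : set X :=
  [set x | `|x| <= 1].

Definition unit_sphere (R : realType) (X : normedModType R) : set X :=
  [set x | `|x| = 1].

(* The library has no topological dual. [dual X] is the space of continuous
   linear maps X -> R, with pointwise operations and the operator norm; it is
   made a completeNormedModType, so that the construction can be iterated to
   get the bidual. The codomain is written R^o, the field seen as a normed
   module over itself, so that linearity and continuity are the generic ones. *)
Section dual_def.
Variables (R : realType) (X : normedModType R).

Definition continuous_linear : {pred X -> R^o} :=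
  mem [set f : X -> R^o | linear f /\ continuous f].

Record dual := Dual {
  dual_fun :> X -> R^o ;
  _ : dual_fun \in continuous_linear }.

HB.instance Definition _ := [isSub for dual_fun].
HB.instance Definition _ := [Choice of dual by <:].

Lemma continuous_linear_submod_closed : submod_closed continuous_linear.
Proof.
split.
  rewrite inE; split=> [a x y|x]; last exact: cst_continuous.
  by rewrite /= scaler0 addr0.
move=> a f g; rewrite !inE => -[lf cf] [lg cg]; split=> [b x y|x].
  rewrite /= !fctE lf lg !scalerDr !scalerA (mulrC a) -!addrA.
  by congr (_ + _); rewrite addrCA.
by apply: continuousD; [apply: continuousZr; exact: cf|exact: cg].
Qed.

HB.instance Definition _ := GRing.isSubmodClosed.Build R (X -> R^o)
  continuous_linear continuous_linear_submod_closed.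
HB.instance Definition _ := [SubChoice_isSubLmodule of dual by <:].

Lemma dualP (f : dual) : linear f /\ continuous f.
Proof. by case: f => f /= /set_mem. Qed.

HB.instance Definition _ (f : dual) :=
  GRing.isLinear.Build R X R^o _ (dual_fun f) (dualP f).1.

Lemma dual_continuous (f : dual) : continuous f.
Proof. exact: (dualP f).2. Qed.

Lemma dualD (f g : dual) x : (f + g) x = f x + g x.
Proof. by []. Qed.

Lemma dualZ a (f : dual) x : (a *: f) x = a * f x.
Proof. by []. Qed.

Lemma dual_eqP (f g : dual) : f =1 g -> f = g.
Proof. by move=> fg; apply/val_inj/funext. Qed.

Definition dual_norm (f : dual) : R :=
  sup [set `|f x| | x in @unit_ball R X].

Lemma dual_norm_has_sup (f : dual) :
  has_sup [set `|f x| | x in @unit_ball R X].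
Proof.
split; first by exists `|f 0|, 0 => //=; rewrite /unit_ball/= normr0.
have /linear_bounded_continuous/bounded_funP/(_ 1)[M fM] := @dual_continuous f.
by exists M => _ [x x1 <-]; exact: fM.
Qed.

Lemma le_dual_norm (f : dual) x : `|x| <= 1 -> `|f x| <= dual_norm f.
Proof.
by move=> x1; apply: (ub_le_sup (dual_norm_has_sup f).2); exists x.
Qed.

Lemma dual_norm_le (f : dual) M :
  (forall x, `|x| <= 1 -> `|f x| <= M) -> dual_norm f <= M.
Proof.
move=> fM; apply: ge_sup; first exact: (dual_norm_has_sup f).1.
by move=> _ [x x1 <-]; exact: fM.
Qed.

Lemma dual_norm_ge0 (f : dual) : 0 <= dual_norm f.
Proof. by apply: le_trans (le_dual_norm f (x := 0) _); rewrite ?normr0. Qed.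

Lemma dual_normM (f : dual) x : `|f x| <= dual_norm f * `|x|.
Proof.
have [->|x0] := eqVneq x 0; first by rewrite linear0 !normr0 mulr0.
rewrite -ler_pdivrMr ?normr_gt0//.
have -> : `|f x| / `|x| = `|f (`|x|^-1 *: x)|.
  by rewrite linearZ normrZ ger0_norm ?invr_ge0// mulrC.
by apply: le_dual_norm; rewrite normrZ ger0_norm ?invr_ge0// mulVf ?normr_eq0.
Qed.

Lemma ler_dual_normD (f g : dual) :
  dual_norm (f + g) <= dual_norm f + dual_norm g.
Proof.
apply: dual_norm_le => x x1; rewrite dualD (le_trans (ler_normD _ _))//.
by rewrite lerD// le_dual_norm.
Qed.

Lemma dual_normZ_le a (f : dual) : dual_norm (a *: f) <= `|a| * dual_norm f.
Proof.
by apply: dual_norm_le => x x1; rewrite dualZ normrM ler_wpM2l// le_dual_norm.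
Qed.

Lemma dual_normZ a (f : dual) : dual_norm (a *: f) = `|a| * dual_norm f.
Proof.
apply/eqP; rewrite eq_le dual_normZ_le/=.
have [->|a0] := eqVneq a 0; first by rewrite normr0 mul0r dual_norm_ge0.
rewrite -ler_pdivlMl ?normr_gt0// -normfV.
by rewrite -[X in dual_norm X <= _](scalerK a0); exact: dual_normZ_le.
Qed.

Lemma dual_norm0_eq0 (f : dual) : dual_norm f = 0 -> f = 0.
Proof.
move=> f0; apply: dual_eqP => x; apply/normr0_eq0/eqP.
by rewrite eq_le normr_ge0 andbT (le_trans (dual_normM _ _))// f0 mul0r.
Qed.

HB.instance Definition _ := @Lmodule_isNormed.Build R dual
  dual_norm ler_dual_normD dual_normZ dual_norm0_eq0.

Lemma dual_normE (f : dual) : `|f| = sup [set `|f x| | x in @unit_ball R X].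
Proof. by []. Qed.

End dual_def.

Section dual_complete.
Variables (R : realType) (X : normedModType R).

Lemma dual_ball_le (f g : dual X) (e : R) x :
  ball f e g -> `|f x - g x| <= e * `|x|.
Proof.
rewrite -ball_normE => /= fge; have -> : f x - g x = (f - g) x by [].
by rewrite (le_trans (dual_normM _ _))// ler_wpM2r// ltW.
Qed.

Lemma dual_complete (F : set_system (dual X)) :
  ProperFilter F -> cauchy F -> cvg F.
Proof.
move=> FF /cauchy_ballP Fc.
have Fev e : 0 < e -> exists2 A, F A &
    forall f g, A f -> A g -> forall x, `|f x - g x| <= e * `|x|.
  move=> e0; have /cauchy_ballP/cauchyP/(_ (e / 2))[|f0 Ff0] := Fc.
    by rewrite divr_gt0.
  exists (ball f0 (e / 2)) => // f g f0f f0g x.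
  rewrite (splitr e) mulrDl.
  rewrite -(subrKA (f0 x)) (le_trans (ler_normD _ _))// lerD//.
    by rewrite distrC; exact: dual_ball_le.
  exact: dual_ball_le.
have Fx x : cvg ((fun f : dual X => f x : R^o) @ F).
  apply: cauchy_cvg; apply/cauchy_ballP => e e0.
  have /Fev[A FA Ae] : 0 < e / (`|x| + 1) by rewrite divr_gt0// ltr_wpDl.
  exists ((fun f : dual X => f x : R^o) @` A, (fun f : dual X => f x : R^o) @` A).
    by split; apply: (@filterS _ F _ A) => // f Af; exists f.
  move=> [_ _] [/= [f Af <-] [g Ag <-]]; rewrite -ball_normE/=.
  rewrite (le_lt_trans (Ae _ _ Af Ag x))// -mulrA gtr_pMr//.
  by rewrite ltr_pdivrMl ?ltr_wpDl// mulr1 ltrDl.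
pose l x : R^o := lim ((fun f : dual X => f x : R^o) @ F).
have ll : linear l.
  move=> a x y; apply: cvg_lim => //=.
  have -> : (fun f : dual X => f (a *: x + y) : R^o)
      = (fun f => a *: (f x : R^o) + f y).
    by apply/funext => f; rewrite linearP.
  by apply: cvgD; [apply: cvgZr; exact: Fx|exact: Fx].
pose L : {linear X -> R^o} := HB.pack l (GRing.isLinear.Build _ _ _ _ _ ll).
have lA e : 0 < e -> exists2 A, F A &
    forall f, A f -> forall x, `|l x - f x| <= e * `|x|.
  move=> /Fev[A FA Ae]; exists A => // f Af x.
  have lfx : (fun g : dual X => `|(g x : R^o) - f x|) @ F --> `|l x - f x|.
    by apply: cvg_norm; apply: cvgB; [exact: Fx|exact: cvg_cst].
  rewrite -(cvg_lim _ lfx)//; apply: limr_le; first by apply/cvg_ex; eexists; exact: lfx.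
  by apply: (@filterS _ F _ A) => // g Ag; exact: Ae.
have lc : continuous l.
  apply: (@bounded_linear_continuous _ _ _ L); apply/bounded_funP => r.
  have [A FA Al] := lA _ ltr01.
  have [f Af] := filter_ex FA.
  exists (r + dual_norm f * r) => x xr.
  rewrite -(subrK (f x) (L x)) (le_trans (ler_normD _ _))// lerD//.
    by rewrite (le_trans (Al _ Af x))// mul1r.
  by rewrite (le_trans (dual_normM _ _))// ler_wpM2l// dual_norm_ge0.
apply/cvg_ex; exists (Dual (mem_set (conj ll lc))).
apply/cvgrPdist_le => e e0; have [A FA Al] := lA _ e0.
apply: (@filterS _ F _ A) => // f Af; apply: dual_norm_le => x x1.
by rewrite (le_trans (Al _ Af x))// ler_piMr// ltW.
Qed.

HB.instance Definition _ := Uniform_isComplete.Build (dual X) dual_complete.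

End dual_complete.

Section geometry.
Variables (R : realType) (X : normedModType R).

Definition slice (f : dual X) (e : R) : set X :=
  [set x | unit_ball x /\ 1 - e < f x].

Definition LD2P_plus : Prop :=
  forall (f : dual X) (e d : R), unit_sphere f -> 0 < e -> 0 < d ->
  forall x : X, (slice f e `&` @unit_sphere R X) x ->
  exists2 y : X, slice f e y & 2 - d < `|x - y|.

Definition smooth : Prop :=
  forall x : X, unit_sphere x ->
  exists! f : dual X, unit_sphere f /\ f x = 1.

End geometry.

(* Main.v *)
(* Every nonzero point x is supported by a functional f of norm at most 1, and
   LD2P+ makes the supporting functional jump: if y is almost antipodal to
   u = x/|x|, then a support functional g of u - y almost supports u while
   g (- y) is almost 1, and by moving from x to x' = x - t y one forces every
   support functional of every point near x' to be at least 1/2 at z = - y.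
   If y is taken in a slice of B_X given by the normalised sum of the
   functionals f_0, ..., f_n found so far, which all almost support x, then
   moreover f_i z <= - 1/2 for all i <= n. Iterating gives x_n -> l, functionals
   f_n supporting x_n and z_n in B_X with f_i (z_n) <= - 1/2 for i <= n, whereas
   g (z_n) >= 1/2 for every g supporting l. Let F in X** and Phi in X*** be the
   limits of (z_n) and (f_n) along a free ultrafilter. Then g and Phi both
   support l/|l| in X**, but g(F) >= 1/2 and Phi(F) <= - 1/2. *)
From HB Require Import structures.
Require Import Defs.
From mathcomp Require Import all_boot all_order all_algebra.
From mathcomp Require Import all_classical all_reals all_analysis.
From mathcomp Require Import ring lra.

Set Implicit Arguments.
Unset Strict Implicit.

Import Order.TTheory GRing.Theory Num.Theory.
Import numFieldNormedType.Exports.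

Local Open Scope classical_set_scope.
Local Open Scope ring_scope.

(** * Hahn-Banach through minimal sublinear functionals *)

Definition sublinear (R : realType) (V : lmodType R) (p : V -> R) : Prop :=
  (forall x y, p (x + y) <= p x + p y) /\
  (forall a x, 0 < a -> p (a *: x) = a * p x).

Lemma sublinear0 (R : realType) (V : lmodType R) (p : V -> R) :
  sublinear p -> p 0 = 0.
Proof. by move=> [_ /(_ 2 0 ltac:(lra))]; rewrite scaler0; lra. Qed.

Lemma sublinearN (R : realType) (V : lmodType R) (p : V -> R) x :
  sublinear p -> - p (- x) <= p x.
Proof.
by move=> sp; have := sp.1 x (- x); rewrite subrr (sublinear0 sp); lra.
Qed.

(** Take q y to be the infimum over t > 0 of p (y + t v) - t p v; it is finite because each value is
    at least - p (- y). The choice t = 1 gives both final bounds. *)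
Lemma sublinear_tilt (R : realType) (V : lmodType R) (p : V -> R) (v : V) :
  sublinear p -> exists q : V -> R,
    [/\ sublinear q, forall y, q y <= p y & q (- v) <= - p v].
Proof.
move=> sp; have [pD pZ] := sp; have p0 := sublinear0 sp.
pose E y := [set p (y + t *: v) - t * p v | t in [set t | 0 < t]].
have Elb y : lbound (E y) (- p (- y)).
  move=> _ [t /= t0 <-]; rewrite -pZ//.
  by have := pD (y + t *: v) (- y); rewrite addrAC subrr add0r; lra.
have Ele y t : 0 < t -> inf (E y) <= p (y + t *: v) - t * p v.
  by move=> t0; apply: ge_inf; [exists (- p (- y))|exists t].
have leE y m : (forall t, 0 < t -> m <= p (y + t *: v) - t * p v) ->
    m <= inf (E y).
  move=> mE; apply: lb_le_inf; last by move=> _ [t t0 <-]; exact: mE.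
  by exists (p (y + 1 *: v) - 1 * p v), 1 => //=.
have EZ a y : 0 < a -> inf (E (a *: y)) <= a * inf (E y).
  move=> a0; rewrite mulrC -ler_pdivrMr//; apply: (leE) => t t0.
  rewrite ler_pdivrMr// (le_trans (Ele _ (a * t) (mulr_gt0 a0 t0)))//.
  by rewrite -scalerA -scalerDr pZ//; lra.
exists (fun y => inf (E y)); split.
- split=> [x y|a x a0].
    rewrite -lerBlDr; apply: (leE) => t t0; rewrite lerBlDl -lerBlDr.
    apply: (leE) => s s0.
    (* Parameters t for x and s for y combine to t + s for x + y. *)
    have := Ele (x + y) (t + s) (addr_gt0 t0 s0).
    rewrite scalerDl addrACA.
    by have := pD (x + t *: v) (y + s *: v); rewrite mulrDl; lra.
  apply/eqP; rewrite eq_le EZ//= -ler_pdivlMl//.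
  have ai : 0 < a^-1 by rewrite invr_gt0.
  by have := EZ _ (a *: x) ai; rewrite scalerA mulVf ?gt_eqF// scale1r.
- by move=> y; have := Ele y 1 ltr01; have := pD y v; rewrite scale1r; lra.
- by have := Ele (- v) 1 ltr01; rewrite scale1r addNr p0; lra.
Qed.

Lemma sublinear_minimal (R : realType) (V : lmodType R) (p : V -> R) :
  sublinear p -> exists q : V -> R,
    [/\ sublinear q, forall y, q y <= p y &
      forall r : V -> R, sublinear r -> (forall y, r y <= q y) -> r = q].
Proof.
move=> sp.
pose T := {q : V -> R | sublinear q /\ forall y, q y <= p y}.
(* The order is reversed, so that a maximal element for Zorn is a minimal functional. *)
pose le (q r : T) := `[< forall y, sval r y <= sval q y >].
have [||||[q [sq qp]] qmin] := @Zorn T le.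
- by move=> q; apply/asboolP.
- move=> q r s /asboolP qr /asboolP rs; apply/asboolP => y.
  exact: le_trans (rs y) (qr y).
- move=> [q qP] [r rP] /asboolP/= qr /asboolP/= rq; apply: eq_exist.
  by apply/funext => y; apply/eqP; rewrite eq_le qr rq.
- move=> A Atot; have [->|/set0P[q0 Aq0]] := eqVneq A set0.
    by exists (exist _ p (conj sp (fun=> lexx _))).
  (* A nonempty chain is bounded by its pointwise infimum, finite since q y >= - q (- y) >= - p (-
     y). For subadditivity, of two members of the chain the smaller one serves for both
     arguments. *)
  pose E y := [set sval q y | q in A].
  have Elb y : lbound (E y) (- p (- y)).
    move=> _ [[q [sq qp]] /= _ <-].
    by apply: le_trans (sublinearN _ sq); rewrite lerN2.
  have Ele y q : A q -> inf (E y) <= sval q y.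
    by move=> Aq; apply: ge_inf; [exists (- p (- y))|exists q].
  have leE y m : (forall q, A q -> m <= sval q y) -> m <= inf (E y).
    move=> mE; apply: lb_le_inf; last by move=> _ [t t0 <-]; exact: mE.
    by exists (sval q0 y), q0.
  have EZ a y : 0 < a -> inf (E (a *: y)) <= a * inf (E y).
    move=> a0; rewrite mulrC -ler_pdivrMr//; apply: (leE) => q Aq.
    by rewrite ler_pdivrMr// (le_trans (Ele _ q Aq))// (svalP q).1.2// mulrC.
  have sE : sublinear (fun y => inf (E y)).
    split=> [x y|a x a0].
      rewrite -lerBlDr; apply: (leE) => q Aq; rewrite lerBlDl -lerBlDr.
      apply: (leE) => r Ar; rewrite lerBlDl.
      have [/asboolP qr|/asboolP rq] := Atot _ _ Aq Ar.
        have := Ele (x + y) r Ar; have := (svalP r).1.1 x y.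
        by have := qr x; lra.
      have := Ele (x + y) q Aq; have := (svalP q).1.1 x y.
      by have := rq y; lra.
    apply/eqP; rewrite eq_le EZ//= -ler_pdivlMl//.
    have ai : 0 < a^-1 by rewrite invr_gt0.
    by have := EZ _ (a *: x) ai; rewrite scalerA mulVf ?gt_eqF// scale1r.
  have Ep y : inf (E y) <= p y by apply: le_trans (Ele y _ Aq0) ((svalP q0).2 y).
  exists (exist _ (fun y => inf (E y)) (conj sE Ep)) => q Aq.
  by apply/asboolP => y /=; exact: Ele.
- exists q; split=> // r sr rq.
  have rp y : r y <= p y := le_trans (rq y) (qp y).
  have /(_ _)/(congr1 sval)/= <-// := qmin (exist _ r (conj sr rp)).
  by apply/asboolP.
Qed.

(* A minimal sublinear functional equals each of its tilts, hence is odd. *)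
Lemma sublinear_dominates_linear (R : realType) (V : lmodType R)
    (p : V -> R) : sublinear p ->
  exists2 f : V -> R^o, linear f & forall y, f y <= p y.
Proof.
move=> /sublinear_minimal[q [sq qp qmin]]; exists q => //.
have [qD qZ] := sq.
have qN v : q (- v) = - q v.
  have [r [sr rq rv]] := sublinear_tilt v sq.
  apply/eqP; rewrite eq_le; have := sublinearN v sq.
  by move: rv; rewrite (qmin r sr rq) => ->/=; lra.
have qA x y : q (x + y) = q x + q y.
  apply/eqP; rewrite eq_le qD/=.
  by have := qD (- x) (- y); rewrite -opprD !qN; lra.
move=> a x y; rewrite qA; congr (_ + _); have [a0|a0|->] := ltgtP a 0.
- by rewrite -[a]opprK scaleNr qN qZ ?oppr_gt0// scaleNr.
- exact: qZ.
- by rewrite !scale0r (sublinear0 sq).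
Qed.

(** * Support functionals and the canonical embedding into the bidual *)

Lemma dual_of_bounded (R : realType) (V : normedModType R) (f : V -> R^o)
    (c : R) :
  0 <= c -> linear f -> (forall x, `|f x| <= c * `|x|) ->
  exists2 F : dual V, `|F| <= c & forall x, F x = f x.
Proof.
move=> c0 lf fle.
have cf : continuous f.
  pose L : {linear V -> R^o} := HB.pack f (GRing.isLinear.Build _ _ _ _ _ lf).
  apply: (@bounded_linear_continuous _ _ _ L); apply/bounded_funP => r.
  by exists (c * r) => x xr; apply: le_trans (fle x) _; rewrite ler_wpM2l.
exists (Dual (mem_set (conj lf cf))) => //.
apply: dual_norm_le => x x1; apply: le_trans (fle x) _.
by rewrite ler_piMr.
Qed.

(** A linear functional below the tilt of the norm at x is below the norm, and its value at - x is
    at most - [|x|]. *)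
Lemma support_functional (R : realType) (V : normedModType R) (x : V) :
  exists2 f : dual V, `|f| <= 1 & f x = `|x|.
Proof.
have sn : sublinear (fun y : V => `|y|).
  by split=> [y z|a y a0]; [exact: ler_normD|rewrite normrZ gtr0_norm].
have [q [sq qn qx]] := sublinear_tilt x sn.
have [f lf fq] := sublinear_dominates_linear sq.
pose F : {linear V -> R^o} := HB.pack f (GRing.isLinear.Build _ _ _ _ _ lf).
have fle y : `|f y| <= `|y|.
  rewrite ler_norml (le_trans (fq y) (qn y)) andbT.
  have := le_trans (fq (- y)) (qn (- y)).
  by rewrite (linearN F y : f (- y) = - f y) normrN; lra.
have [|G G1 Gf] := dual_of_bounded ler01 lf; first by move=> y; rewrite mul1r.
exists G => //.
rewrite Gf; apply/eqP; rewrite eq_le (le_trans (ler_norm _) (fle x))/=.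
by have := fq (- x); rewrite (linearN F x : f (- x) = - f x); lra.
Qed.

Lemma le_dual_app (R : realType) (V : normedModType R) (f : dual V) (x : V) :
  `|f| <= 1 -> `|f x| <= `|x|.
Proof.
move=> f1; apply: le_trans (dual_normM f x) _.
by rewrite -[leRHS]mul1r ler_wpM2r.
Qed.

Lemma bidual_embedding (R : realType) (V : normedModType R) (x : V) :
  exists2 F : dual (dual V), `|F| <= `|x| & forall f, F f = f x.
Proof.
apply: (@dual_of_bounded R (dual V) (fun f => f x)) => [//|a f g //|f].
by rewrite mulrC; exact: dual_normM.
Qed.

(** * Weak-star limits along an ultrafilter *)

Lemma ultrafilter_cvg_bounded (R : realType) (T : Type) (U : set_system T)
    (u : T -> R) (M : R) :
  UltraFilter U -> (forall n, `|u n| <= M) ->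
  exists2 l : R, u @ U --> l & `|l| <= M.
Proof.
move=> UU uM; have PU : ProperFilter U := @ultra_proper _ _ UU.
have [|l [lM cl]] := @segment_compact R (- M) M (u @ U) _.
  apply: (@filterE _ U) => n; rewrite /= in_itv/= -ler_norml; exact: uM.
exists l; last by move: lM; rewrite /= in_itv/= -ler_norml.
(* An ultrafilter converges to its cluster points: otherwise it would contain the preimage of the
   complement of a neighbourhood of l. *)
move=> A lA; have [//|uA] := in_ultra_setVsetC (u @^-1` A) UU.
by have [y [/= nAy Ay]] := cl (~` A) A uA lA.
Qed.

(** This is the form of Banach-Alaoglu used to produce elements of the bidual and of the third
    dual. *)
Lemma dual_ultralimit (R : realType) (V : normedModType R)
    (U : set_system nat) (f : nat -> dual V) :
  UltraFilter U -> (forall n, `|f n| <= 1) ->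
  exists2 F : dual V, `|F| <= 1 & forall x, (f n x : R^o) @[n --> U] --> F x.
Proof.
move=> UU f1; have PU : ProperFilter U := @ultra_proper _ _ UU.
have /choice[g gP] : forall x : V, exists l : R^o,
    (f n x : R^o) @[n --> U] --> l /\ `|l| <= `|x|.
  move=> x; have [|l fl lx] := @ultrafilter_cvg_bounded R _ _ (fun n => f n x) `|x| UU.
    by move=> n; exact: le_dual_app.
  by exists l.
have lg : linear g.
  move=> a x y; apply: cvg_unique (gP (a *: x + y)).1 _ => //.
  have -> : (fun n => f n (a *: x + y) : R^o)
      = (fun n => a *: (f n x : R^o) + f n y).
    by apply/funext => n; rewrite linearP.
  by apply: cvgD; [apply: cvgZl_tmp|]; exact: (gP _).1.
have [|F F1 Fg] := dual_of_bounded ler01 lg.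
  by move=> x; rewrite mul1r; exact: (gP x).2.
by exists F => // x; rewrite Fg; exact: (gP x).1.
Qed.

(** * The defect of a list of functionals, and one perturbation step under LD2P+ *)

(* For L in the dual unit ball every term is nonnegative: a defect below |x|/2
   keeps the sum of L of norm greater than size L - 1/2, so that a point of B_X
   in the corresponding slice is sent above 1/2 by each member of L. *)
Definition defect (R : realType) (V : normedModType R) (L : seq (dual V))
  (x : V) : R := \sum_(f <- L) (`|x| - f x).

Lemma defectE (R : realType) (V : normedModType R) (L : seq (dual V)) (x : V) :
  defect L x = (size L)%:R * `|x| - (\sum_(f <- L) f) x.
Proof.
rewrite /defect; elim: L => [|f L IH]; first by rewrite !big_nil mul0r subrr.
by rewrite !big_cons IH dualD /= -natr1; lra.
Qed.

Lemma sub_norm_le_defect (R : realType) (V : normedModType R)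
    (L : seq (dual V)) (f : dual V) (x : V) :
  (forall g, g \in L -> `|g| <= 1) -> f \in L -> `|x| - f x <= defect L x.
Proof.
move=> L1 fL; rewrite /defect (big_rem f)//= lerDl big_seq sumr_ge0// => g gL.
by rewrite subr_ge0 (le_trans (ler_norm _))// le_dual_app// L1//; apply: mem_rem gL.
Qed.

Lemma defect_dist (R : realType) (V : normedModType R) (L : seq (dual V))
    (x y : V) :
  (forall f, f \in L -> `|f| <= 1) ->
  defect L y <= defect L x + (size L)%:R * (2 * `|y - x|).
Proof.
rewrite /defect; elim: L => [|f L IH] L1; first by rewrite !big_nil mul0r addr0.
rewrite !big_cons /= -natr1.
have /IH {}IH : forall g, g \in L -> `|g| <= 1.
  by move=> g gL; apply: L1; rewrite inE gL orbT.
have f1 : `|f| <= 1 by apply: L1; rewrite inE eqxx.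
have := le_dual_app (y - x) f1; rewrite ler_norml linearB/= => /andP[fl _].
have := lerB_dist y x.
by lra.
Qed.

Lemma LD2P_plus_far_point (R : realType) (X : normedModType R)
    (L : seq (dual X)) (x : X) (d : R) :
  LD2P_plus X -> (forall f, f \in L -> `|f| <= 1) -> L != [::] ->
  defect L x < `|x| / 2 -> 0 < d ->
  exists y : X, [/\ `|y| <= 1, forall f, f \in L -> 1 / 2 <= f y &
    2 - d < `|(`|x|^-1 *: x) - y|].
Proof.
move=> ld L1 L0 Lx d0.
have x0 : 0 < `|x|.
  rewrite normr_gt0; apply: contraTneq Lx => ->.
  by rewrite defectE linear0 normr0; lra.
pose s := \sum_(f <- L) f; pose u := `|x|^-1 *: x; pose N : R := (size L)%:R.
have N1 : 1 <= N by rewrite /N ler1n lt0n size_eq0.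
have u1 : `|u| = 1 by rewrite normrZ normfV normr_id mulVf ?gt_eqF.
have su : N - 2^-1 < s u.
  rewrite linearZ/= -ltr_pdivrMl ?invrK ?invr_gt0//.
  by move: Lx; rewrite defectE -/s -/N; lra.
have sn : s u <= `|s|.
  by have := dual_normM s u; rewrite u1 mulr1; apply: le_trans; exact: ler_norm.
have s0 : 0 < `|s| by lra.
have hE v : (`|s|^-1 *: s) v = s v / `|s| by rewrite dualZ mulrC.
(* With this width, the slice of the normalised s is the part of the ball where s > N - 1/2. *)
have e0 : 0 < 1 - (N - 2^-1) / `|s|.
  by rewrite subr_gt0 ltr_pdivrMr// mul1r; lra.
have [||y [y1 sy] uy] := ld (`|s|^-1 *: s) _ _ _ e0 d0 u.
- by rewrite /unit_sphere/= normrZ normfV normr_id mulVf ?gt_eqF.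
- split; last exact: u1.
  split; first by rewrite /unit_ball/= u1.
  by rewrite hE opprB addrC subrK ltr_pM2r ?invr_gt0.
exists y; split=> // f fL.
move: sy; rewrite hE opprB addrC subrK ltr_pM2r ?invr_gt0// => sy.
have := sub_norm_le_defect y L1 fL; rewrite defectE -/s -/N.
(* The defect at y is below N [|y|] - N + 1/2, whence f y > 1/2 + (N - 1)(1 - [|y|]). *)
have : 0 <= (N - 1) * (1 - `|y|) by rewrite mulr_ge0 ?subr_ge0.
by lra.
Qed.

Lemma LD2P_plus_step (R : realType) (X : normedModType R)
    (L : seq (dual X)) (x : X) (r : R) :
  LD2P_plus X -> (forall f, f \in L -> `|f| <= 1) -> L != [::] ->
  defect L x < `|x| / 2 -> 0 < r ->
  exists (x' z : X) (r' : R),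
    [/\ defect L x' < `|x'| / 2, 0 < r' <= r / 2,
      forall w, `|w - x'| <= r' -> `|w - x| <= r,
      `|z| <= 1 /\ (forall f, f \in L -> f z <= - (1 / 2)) &
      forall w (f : dual X), `|w - x'| <= r' -> `|f| <= 1 -> f w = `|w| ->
        1 / 2 <= f z].
Proof.
move=> ld L1 L0 Lx r0.
have x0 : 0 < `|x|.
  rewrite normr_gt0; apply: contraTneq Lx => ->.
  by rewrite defectE linear0 normr0; lra.
pose N : R := (size L)%:R; set a := `|x| / 2 - defect L x.
have a0 : 0 < a by rewrite subr_gt0.
have N0 : 0 <= N by rewrite /N.
(* The first bound keeps the new ball inside the old one. The second absorbs the change of the
   defect, at most 2 N t, and of half the norm, at most t / 2. *)
pose t := Num.min (r / 2) (a / (3 * N + 1)).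
have t0 : 0 < t by rewrite lt_min !divr_gt0//; lra.
have tr : t <= r / 2 by rewrite ge_min lexx.
have ta : t * (3 * N + 1) <= a.
  by rewrite -ler_pdivlMr; [rewrite ge_min lexx orbT|lra].
pose d := t / (4 * (`|x| + t)).
have d0 : 0 < d by rewrite divr_gt0//; lra.
have dx : d * (`|x| + t) = t / 4 by rewrite /d; field; lra.
have [y [y1 Ly uy]] := LD2P_plus_far_point ld L1 L0 Lx d0.
have [g g1] := support_functional (`|x|^-1 *: x - y).
rewrite linearB linearZ/= => gE.
(* The values of g at x/[|x|] and at - y are at most 1 and add up to more than 2 - d, so both exceed
   1 - d. *)
have gx : `|x| * (1 - d) <= g x.
  have gy : - g y <= 1.
    rewrite -linearN (le_trans (ler_norm _))// (le_trans (le_dual_app _ g1))//.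
    by rewrite normrN.
  by rewrite mulrC -ler_pdivlMr// mulrC; move: uy gE; rewrite /GRing.scale/=; lra.
have gy : 1 - d <= - g y.
  have gx1 : `|x|^-1 * g x <= 1.
    rewrite mulrC ler_pdivrMr// mul1r (le_trans (ler_norm _))//.
    exact: le_dual_app.
  by move: uy gE gx1; rewrite /GRing.scale/=; lra.
pose x' := x - t *: y.
have fx' (f : dual X) : f x' = f x - t * f y by rewrite linearB linearZ.
have xx' : `|x' - x| <= t.
  by rewrite /x' addrAC subrr add0r normrN normrZ gtr0_norm// ler_piMr// ltW.
have x'ge : (`|x| + t) * (1 - d) <= `|x'|.
  apply: le_trans (le_trans (ler_norm _) (le_dual_app x' g1)).
  rewrite fx'; have : 0 <= t * (- g y - (1 - d)) by rewrite mulr_ge0 ?subr_ge0// ltW.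
  by lra.
exists x', (- y), (t / 8); split.
- have := defect_dist x x' L1.
  have := lerB_dist x x'; rewrite distrC.
  have : N * (2 * `|x' - x|) <= N * (2 * t) by rewrite ler_wpM2l//; lra.
  have : 0 <= t * N by rewrite mulr_ge0// ltW.
  by move: ta; rewrite /a -/N; lra.
- by apply/andP; split; lra.
- move=> w wx'; rewrite -(subrKA x') (le_trans (ler_normD _ _))//.
  by lra.
- split; first by rewrite normrN.
  by move=> f fL; rewrite linearN; have := Ly f fL; lra.
- move=> w f wx' f1 fw; rewrite linearN/=.
  have fx : f x <= `|x| by rewrite (le_trans (ler_norm _))// le_dual_app.
  have := le_trans (ler_norm _) (le_dual_app (w - x') f1).
  rewrite linearB/= fw fx' => fwx'.
  have := lerB_dist x' w; rewrite distrC => x'w.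
  (* By the choice of d, [|x'|] >= [|x|] + 3t/4. Passing from x' to w costs t/8 in the norm and t/8
     in f, which leaves t/2. *)
  have tf : t / 2 <= t * (- f y) by lra.
  by rewrite -(ler_pM2l t0); lra.
Qed.

(** * Iteration of the step and its limit point *)

Lemma nested_ball_limit (R : realType) (X : completeNormedModType R)
    (x : nat -> X) (r : nat -> R) :
  (forall n, 0 < r n.+1 <= r n / 2) ->
  (forall n w, `|w - x n.+1| <= r n.+1 -> `|w - x n| <= r n) ->
  r n @[n --> \oo] --> (0 : R) /\
  exists l : X, forall n, `|l - x n| <= r n.
Proof.
move=> rS ballS.
have r0 n : 0 < r n by have /andP[] := rS n; lra.
have rle n : r n <= r 0%N * 2^-1 ^+ n.
  elim: n => [|n IH]; first by rewrite expr0 mulr1.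
  by have /andP[_] := rS n; rewrite exprSr; lra.
have r_cvg : r n @[n --> \oo] --> (0 : R).
  apply: (@squeeze_cvgr _ _ _ _ (cst 0) (fun n => r 0%N * 2^-1 ^+ n)).
  - by near=> n; rewrite rle ltW.
  - exact: cvg_cst.
  - rewrite -[X in _ --> X](mulr0 (r 0%N)); apply: cvgMr.
    by apply: cvg_expr; rewrite ger0_norm ?invr_ge0// invf_lt1 ?ltr1n.
split=> //.
have nested n k w : `|w - x (n + k)%N| <= r (n + k)%N -> `|w - x n| <= r n.
  by elim: k => [|k IH]; rewrite ?addn0// addnS => /ballS.
have xx n m : (n <= m)%N -> `|x m - x n| <= r n.
  by move=> /subnKC <-; apply: (nested _ (m - n)%N); rewrite subrr normr0 ltW.
have xcvg : cvg (x @ \oo).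
  apply: cauchy_cvg; apply: cauchy_exP => e e0.
  have [N _ rN] : \forall n \near \oo, r n < e by exact: cvgr_lt r_cvg _ e0.
  exists (x N), N => // m /= Nm.
  by rewrite -ball_normE/= distrC (le_lt_trans (xx _ _ Nm))// rN/=.
exists (lim (x @ \oo)) => n.
have lx : `|x m - x n| @[m --> \oo] --> `|lim (x @ \oo) - x n|.
  by apply: cvg_norm; apply: cvgB => //; exact: cvg_cst.
rewrite -(cvg_lim _ lx)//; apply: limr_le; first by apply/cvg_ex; eexists; exact: lx.
by exists n => // m /= nm; exact: xx.
Unshelve. all: by end_near. Qed.

Lemma LD2P_plus_separating_sequences (R : realType)
    (X : completeNormedModType R) :
  (exists x : X, x != 0) -> LD2P_plus X ->
  exists (l : X) (f : nat -> dual X) (z : nat -> X),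
    [/\ l != 0 /\ (forall n, `|f n| <= 1), forall n, `|z n| <= 1,
      f n l @[n --> \oo] --> `|l|,
      forall i n, (i <= n)%N -> f i (z n) <= - (1 / 2) &
      forall (g : dual X) n, `|g| <= 1 -> g l = `|l| -> 1 / 2 <= g (z n)].
Proof.
move=> [x0 x0_neq0] ld.
pose valid (s : X * R * seq (dual X)) :=
  [/\ forall f, f \in s.2 -> `|f| <= 1, defect s.2 s.1.1 < `|s.1.1| / 2 &
    0 < s.1.2].
pose T := {s | valid s}.
pose next (s s' : T) (f : dual X) (z : X) :=
  let: (x, r, L) := sval s in let: (x', r', L') := sval s' in
  [/\ [/\ L' = f :: L, `|f| <= 1 & f x = `|x|], 0 < r' <= r / 2,
      forall w, `|w - x'| <= r' -> `|w - x| <= r,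
      `|z| <= 1 /\ (forall f, f \in L' -> f z <= - (1 / 2)) &
      forall w (f : dual X), `|w - x'| <= r' -> `|f| <= 1 -> f w = `|w| ->
        1 / 2 <= f z].
have nextP s : exists s', exists f z, next s s' f z.
  case: s => [[[x r] L] [/= L1 Lx r0]].
  have [f f1 fx] := support_functional x.
  (* Adding a support functional of x leaves the defect at x unchanged and makes the list nonempty,
     as the step requires. *)
  have fL1 g : g \in f :: L -> `|g| <= 1.
    by rewrite inE => /orP[/eqP->//|]; exact: L1.
  have fLx : defect (f :: L) x < `|x| / 2.
    by rewrite /defect big_cons fx subrr add0r.
  have [x' [z [r' [Lx' r'r ball' zL zf]]]] := LD2P_plus_step ld fL1 isT fLx r0.
  have v' : valid (x', r', f :: L) by split => //; case/andP: r'r.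
  by exists (exist _ _ v'), f, z; split.
(* The initial radius [|x0| / 2] keeps the limit away from 0. *)
have v0 : valid (x0, `|x0| / 2, [::]).
  have := x0_neq0; rewrite -normr_gt0 => x0_gt0.
  by split=> //=; rewrite ?/defect ?big_nil divr_gt0.
have [s [s0 sS]] := dependent_choice (fun s => cid (nextP s)) (exist _ _ v0).
have /choice[f /choice[z sfz]] := sS.
pose x n := (sval (s n)).1.1; pose r n := (sval (s n)).1.2.
pose L n := (sval (s n)).2.
have S n : [/\ [/\ L n.+1 = f n :: L n, `|f n| <= 1 & f n (x n) = `|x n|],
      0 < r n.+1 <= r n / 2,
      forall w, `|w - x n.+1| <= r n.+1 -> `|w - x n| <= r n,
      `|z n| <= 1 /\ (forall g, g \in L n.+1 -> g (z n) <= - (1 / 2)) &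
      forall w (g : dual X), `|w - x n.+1| <= r n.+1 -> `|g| <= 1 ->
        g w = `|w| -> 1 / 2 <= g (z n)].
  have := sfz n; rewrite /next /x /r /L.
  by case: (sval (s n)) => -[? ?] ?; case: (sval (s n.+1)) => -[? ?] ?.
have [r_cvg [l lx]] : r n @[n --> \oo] --> (0 : R) /\
    exists l : X, forall n, `|l - x n| <= r n.
  by apply: nested_ball_limit => n; have [] := S n.
have fL i n : (i <= n)%N -> f i \in L n.+1.
  elim: n => [|n IH] in_.
    by have [[-> _ _] _ _ _ _] := S 0%N; move: in_; rewrite leqn0 => /eqP ->; rewrite inE eqxx.
  have [[-> _ _] _ _ _ _] := S n.+1; rewrite inE.
  by move: in_; rewrite leq_eqVlt => /orP[/eqP->|/IH->]; rewrite ?eqxx ?orbT.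
exists l, f, z; split.
- split; last by move=> n; have [[]] := S n.
  have := lx 0%N; rewrite /x /r s0 /= => lx0.
  have := x0_neq0; rewrite -!normr_gt0.
  by have := lerB_dist x0 l; rewrite distrC; lra.
- by move=> n; have [_ _ _ []] := S n.
- apply/cvgrPdist_le => e e0.
  (* Since f n supports x n, both [|l|] and f n l are within r n of [|x n|]. *)
  have : \forall n \near \oo, r n < e / 2 by apply: cvgr_lt r_cvg _ _; lra.
  apply: filterS => n rn; have [[_ f1 fx] _ _ _ _] := S n.
  have := le_dual_app (l - x n) f1; rewrite linearB/= fx.
  have := lx n; have := ler_dist_dist l (x n).
  rewrite !ler_norml => /andP[? ?] ? /andP[? ?].
  by apply/andP; split; lra.
- by move=> i n /fL; have [_ _ _ [_ zL] _] := S n; exact: zL.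
- by move=> g n g1 gl; have [_ _ _ _ zg] := S n; exact: zg (lx n.+1) g1 gl.
Qed.

(** * Two distinct support functionals at one point of the bidual *)

Theorem corollary3p7 (R : realType) (X : completeNormedModType R)
  (X_neq0 : exists x : X, x != 0) (X_LD2P : LD2P_plus X) :
  ~ smooth (dual (dual X)).
Proof.
move=> sm.
have [l [f [z [[l0 f1] z1 fl fz zg]]]] :=
  LD2P_plus_separating_sequences X_neq0 X_LD2P.
(* U refines the filter at infinity, so ordinary limits and eventual inequalities pass to U. *)
have [U [UU oU]] := @ultraFilterLemma _ (nbhs \oo) _.
have PU : ProperFilter U := @ultra_proper _ _ UU.
have [g g1 gl] := support_functional l.
have /choice[Z Zz] n : exists F : dual (dual X),
    `|F| <= 1 /\ forall h, F h = h (z n).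
  have [F Fn Fh] := bidual_embedding (z n).
  by exists F; split=> //; exact: le_trans (z1 n).
have /choice[Y Yf] n : exists F : dual (dual (dual X)),
    `|F| <= 1 /\ forall h, F h = h (f n).
  have [F Fn Fh] := bidual_embedding (f n).
  by exists F; split=> //; exact: le_trans (f1 n).
have [F F1 ZF] := dual_ultralimit UU (fun n => (Zz n).1).
have [Phi Phi1 YPhi] := dual_ultralimit UU (fun n => (Yf n).1).
have [G Gg Gh] := bidual_embedding g.
have l_gt0 : 0 < `|l| by rewrite normr_gt0.
pose u := `|l|^-1 *: l.
have u1 : `|u| = 1 by rewrite normrZ normfV normr_id mulVf ?gt_eqF.
have [e eu eh] := bidual_embedding u.
have eg : e g = 1 by rewrite eh linearZ/= gl; apply: mulVf; rewrite gt_eqF.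
(* The embedding only bounds the norm above; the value 1 at g gives the lower bound. *)
have e1 : `|e| = 1.
  apply/eqP; rewrite eq_le -{1}u1 eu/= -eg (le_trans (ler_norm _))//.
  by apply: le_trans (dual_normM e g) _; apply: ler_piMr => //; exact: dual_norm_ge0.
have support1 (H : dual (dual (dual X))) :
    `|H| <= 1 -> H e = 1 -> unit_sphere H /\ H e = 1.
  move=> H1 He; split=> //; apply/eqP; rewrite eq_le H1/=.
  by have := dual_normM H e; rewrite He normr1 e1 mulr1.
have Phie : Phi e = 1.
  apply: cvg_unique (YPhi e) _ => //.
  have -> : (fun n => Y n e : R^o) = (fun n => `|l|^-1 * f n l).
    by apply/funext => n; rewrite (Yf n).2 eh linearZ.
  have -> : 1 = `|l|^-1 * `|l| :> R by rewrite mulVf ?gt_eqF.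
  apply: cvgMr.
  by apply: cvg_trans fl => A /oU.
have [H [_ Huniq]] := sm e e1.
have GPhi : G = Phi.
  rewrite -(Huniq G) ?(Huniq Phi)//; apply: support1 => //.
  - exact: le_trans g1.
  - by rewrite Gh.
have PhiF : Phi F <= - (1 / 2).
  (* The limits are iterated: for fixed i, letting n run along U over n >= i bounds F (f i), and
     then i runs along U. *)
  apply: (closed_cvg (fun y : R => y <= - (1 / 2)) _ _ _ (YPhi F)).
    exact: closed_le.
  apply: filterE => i; rewrite (Yf i).2.
  apply: (closed_cvg (fun y : R => y <= - (1 / 2)) _ _ _ (ZF (f i))).
    exact: closed_le.
  by apply: oU; exists i => // n /= ni; rewrite (Zz n).2; exact: fz.
have FG : 1 / 2 <= G F.
  rewrite Gh; apply: (closed_cvg (fun y : R => 1 / 2 <= y) _ _ _ (ZF g)).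
    exact: closed_ge.
  by apply: filterE => n; rewrite (Zz n).2; exact: zg.
by move: FG; rewrite GPhi; lra.
Qed.
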